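(* Let $\mathbb{F}$ be a field, let $n_0,\dots,n_\ell$ be non-negative integers, and let $A_\bullet=(A_1,\dots,A_\ell)$ be a sequence of matrices over $\mathbb{F}$ with $A_i$ of size $n_i\times n_{i-1}$, i.e. a persistence module $$\mathbb{F}^{n_0}\xrightarrow{A_1}\mathbb{F}^{n_1}\xrightarrow{A_2}\cdots\xrightarrow{A_\ell}\mathbb{F}^{n_\ell}.$$ Then there is $g=(g_0,\dots,g_\ell)\in G=\prod_{i=0}^{\ell}\mathrm{GL}(n_i;\mathbb{F})$ such that every matrix $(gA)_i=g_iA_ig_{i-1}^{-1}$, $1\le i\le\ell$, is in barcode form.
   Context: An $m\times n$ matrix $A$ of rank $r$ is in barcode form if there is a strictly increasing function $c:\{1,\dots,r\}\to\{1,\dots,n\}$ such that $A_{ij}=1$ if $i\le r$ and $j=c(i)$, and $A_{ij}=0$ otherwise. *)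

(* Defs.v *)
From mathcomp Require Import all_boot all_order all_algebra.

Set Implicit Arguments.
Unset Strict Implicit.
Unset Printing Implicit Defensive.

Import GRing.Theory.
Local Open Scope ring_scope.

(* Row and column indices start at 0: row i lies among the first \rank A rows
   exactly when i is the value of some k : 'I_(\rank A). *)
Definition barcode_form (F : fieldType) (m n : nat) (A : 'M[F]_(m, n)) : Prop :=
  exists c : 'I_(\rank A) -> 'I_n,
    {homo c : k k' / (k < k')%N} /\
    forall (i : 'I_m) (j : 'I_n),
      A i j = if [exists k : 'I_(\rank A), (k == i :> nat) && (j == c k)]
              then 1 else 0.

(* The l maps are indexed from 0: i : 'I_l stands for the (i+1)-st map, from
   the space of index [vsrc i] = i to that of index [vtgt i] = i + 1. *)
Definition vsrc (l : nat) (i : 'I_l) : 'I_l.+1 := widen_ord (leqnSn l) i.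
Definition vtgt (l : nat) (i : 'I_l) : 'I_l.+1 := lift ord0 i.

Definition persistence_module (F : fieldType) (l : nat) (n : 'I_l.+1 -> nat) :=
  forall i : 'I_l, 'M[F]_(n (vtgt i), n (vsrc i)).

(* Invertible matrices are given by [unitmx] since the library's general linear
   group type {'GL_n[F]} does not cover size 0. *)
Definition in_GLprod (F : fieldType) (l : nat) (n : 'I_l.+1 -> nat)
    (g : forall i : 'I_l.+1, 'M[F]_(n i)) : Prop :=
  forall i, g i \in unitmx.

Definition gl_act (F : fieldType) (l : nat) (n : 'I_l.+1 -> nat)
    (g : forall i : 'I_l.+1, 'M[F]_(n i)) (A : persistence_module F n) :
    persistence_module F n :=
  fun i => g (vtgt i) *m A i *m invmx (g (vsrc i)).

(* Main.v *)
Require Import Defs.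
From mathcomp Require Import all_boot all_order all_algebra.

(** Proceed from the last vector space to the first, keeping the component of
    [g] at the current space upper triangular.  Given [A], Gaussian
    elimination yields an invertible [h] with [h *m A] in (unreduced) row
    echelon form, and this form survives left multiplication by any upper
    triangular [U].  A row echelon matrix [M] factors as [B *m W] with [B] in
    barcode form and [W] upper triangular: the row of [W] at the pivot column of
    row [k] of [M] is that row [k], and the other rows are those of the identity.
    So [U *m h *m A *m invmx W] is in barcode form, and [W] is the next
    component of [g]. *)

Set Implicit Arguments.
Unset Strict Implicit.
Unset Printing Implicit Defensive.

Import GRing.Theory.
Local Open Scope ring_scope.

(** [is_trig_mx] means lower triangular, hence the transpose. *)
Definition is_utrig_mx (F : fieldType) (n : nat) (U : 'M[F]_n) : bool :=
  is_trig_mx U^T.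

Lemma is_utrig_mxP (F : fieldType) (n : nat) (U : 'M[F]_n) :
  reflect (forall i j : 'I_n, (j < i)%N -> U i j = 0) (is_utrig_mx U).
Proof.
apply: (iffP is_trig_mxP) => U0 i j lt_ij; first by rewrite -(U0 j i) // mxE.
by rewrite mxE U0.
Qed.

Lemma utrig_unitmx (F : fieldType) (n : nat) (U : 'M[F]_n) :
  is_utrig_mx U -> (U \in unitmx) = [forall i, U i i != 0].
Proof.
move=> Utrig; rewrite -unitmx_tr unitmxE det_trig // unitfE.
apply/prodf_neq0/forallP => U0 i; first by have := U0 i isT; rewrite mxE.
by move=> _; rewrite mxE.
Qed.

(* Only the values [c k] with [k < r] are meaningful. *)
Definition increasing_pivots (m n r : nat) (c : nat -> nat) : Prop :=
  [/\ (r <= m)%N, forall k, (k < r)%N -> (c k < n)%N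
    & forall k k', (k < k')%N -> (k' < r)%N -> (c k < c k')%N].

(** Pivots need not be [1] and entries above a pivot are arbitrary: a reduced form would not survive
    left multiplication by upper triangular matrices. *)
Definition echelon (F : fieldType) (m n : nat) (M : 'M[F]_(m, n)) r c : Prop :=
  [/\ increasing_pivots m n r c,
      forall i j, M i j != 0 -> (i < r)%N && (c i <= j)%N
    & forall (i : 'I_m) (j : 'I_n), (i < r)%N -> c i = j -> M i j != 0].

Lemma increasing_pivots_leq (m n r : nat) (c : nat -> nat) (k k' : nat) :
  increasing_pivots m n r c -> (k <= k')%N -> (k' < r)%N -> (c k <= c k')%N.
Proof.
case=> _ _ c_incr; rewrite leq_eqVlt => /predU1P[-> // | lt_kk' lt_k'r].
exact/ltnW/c_incr.
Qed.

Lemma increasing_pivots_inj (m n r : nat) (c : nat -> nat) (k k' : nat) :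
  increasing_pivots m n r c -> (k < r)%N -> (k' < r)%N -> c k = c k' -> k = k'.
Proof.
case=> _ _ c_incr lt_kr lt_k'r eq_c.
case: (ltngtP k k') => // lt_k.
  by have := c_incr _ _ lt_k lt_k'r; rewrite eq_c ltnn.
by have := c_incr _ _ lt_k lt_kr; rewrite eq_c ltnn.
Qed.

Lemma echelon_shift (F : fieldType) (m n : nat) (M : 'M[F]_(m, n)) r c :
  echelon M r c ->
  echelon (row_mx (0 : 'M_(m, 1)) M) r (fun k => (c k).+1).
Proof.
case=> -[le_rm c_lt c_incr] M_supp M_piv; split; first by split.
  move=> i j; case: (split_ordP j) => {}j ->.
    by rewrite row_mxEl mxE eqxx.
  by rewrite row_mxEr /= add1n ltnS; apply: M_supp.
move=> i j; case: (split_ordP j) => {}j -> lt_ir /=.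
  by rewrite ord1.
by rewrite row_mxEr add1n => -[]; apply: M_piv.
Qed.

Lemma echelon_pivot (F : fieldType) (m n : nat) (a : 'M[F]_1) (x : 'rV[F]_n)
    (M : 'M[F]_(m, n)) r c :
  a 0 0 != 0 -> echelon M r c ->
  echelon (block_mx a x 0 M) r.+1 (fun k => if k is k'.+1 then (c k').+1 else 0).
Proof.
move=> a0 [[le_rm c_lt c_incr] M_supp M_piv]; split.
- split=> //; first by case=> // k; apply: c_lt.
  by case=> [|k] [|k'] //; rewrite !ltnS; apply: c_incr.
- move=> i j; case: (split_ordP i) => {}i ->; first by rewrite ord1.
  case: (split_ordP j) => {}j ->; first by rewrite block_mxEdl mxE eqxx.
  by rewrite block_mxEdr /= !add1n !ltnS; apply: M_supp.
- move=> i j; case: (split_ordP i) => {}i ->; case: (split_ordP j) => {}j -> /=.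
  + by rewrite block_mxEul !ord1.
  + by rewrite ord1.
  + by rewrite (ord1 j).
  + by rewrite block_mxEdr !add1n ltnS => lt_ir []; apply: M_piv.
Qed.

(** Induction on the number of columns: a zero first column is skipped; a nonzero one is reduced to
    its top entry, and the rows below the first are treated recursively. *)
Lemma echelon_exists (F : fieldType) (m n : nat) (A : 'M[F]_(m, n)) :
  exists h : 'M[F]_m, h \in unitmx /\ exists r c, echelon (h *m A) r c.
Proof.
elim: n m A => [|n IHn] m A.
  exists 1%:M; split; first exact: unitmx1.
  by exists 0, id; split=> [|i []|i []].
rewrite -[n.+1]/(1 + n)%N in A *; rewrite -[A]hsubmxK.
move: (lsubmx A) (rsubmx A) => v B {A}.
have [->|v_neq0] := eqVneq v 0.
  have [h [h_unit [r [c hB]]]] := IHn m B.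
  exists h; split=> //; exists r, (fun k => (c k).+1).
  by rewrite mul_mx_row mulmx0; apply: echelon_shift.
case: m v B v_neq0 => [|m] v B v_neq0; first by rewrite flatmx0 eqxx in v_neq0.
rewrite -[m.+1]/(1 + m)%N in v B v_neq0 *.
(* Since the column [v] has rank 1, it is [col_ebase v *m pid_mx 1 *m row_ebase v]. Undoing the
   first factor leaves a single top entry, that of the invertible 1 by 1 matrix [row_ebase v]. *)
pose h1 := invmx (col_ebase v).
have h1_unit : h1 \in unitmx by rewrite unitmx_inv col_ebase_unit.
have rank_v : \rank v = 1%N.
  by apply/eqP; rewrite eqn_leq rank_leq_col lt0n mxrank_eq0.
have h1v : h1 *m v = col_mx (row_ebase v) 0.
  rewrite -[RHS](mulKmx (col_ebase_unit v)) -/h1; congr (h1 *m _).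
  rewrite -[LHS]mulmx_ebase -mulmxA rank_v pid_mx_col.
  by rewrite mul_col_mx mul1mx mul0mx.
have [h2 [h2_unit [r [c h2B]]]] := IHn m (dsubmx (h1 *m B)).
exists (block_mx 1%:M 0 0 h2 *m h1); split.
  by rewrite unitmx_mul h1_unit unitmxE det_ublock det1 mul1r -unitmxE h2_unit.
exists r.+1, (fun k => if k is k'.+1 then (c k').+1 else 0).
rewrite -mulmxA mul_mx_row h1v -[h1 *m B]vsubmxK -block_mxEh mulmx_block.
rewrite !mul1mx !mul0mx !mulmx0 !addr0 !add0r.
apply: echelon_pivot => //.
by have := row_ebase_unit v; rewrite unitmxE det_mx11 unitfE.
Qed.

(** For [i < r], row [i] of the product is [U i i] times row [i] of [M] plus multiples of lower
    rows, which vanish up to and including column [c i]. So pivots are rescaled but stay in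
    place. *)
Lemma echelon_mul_utrig (F : fieldType) (m n : nat) (U : 'M[F]_m)
    (M : 'M[F]_(m, n)) r c :
  is_utrig_mx U -> U \in unitmx -> echelon M r c -> echelon (U *m M) r c.
Proof.
move=> Utrig; rewrite utrig_unitmx // => /forallP U_diag.
move/is_utrig_mxP: Utrig => Utrig [piv M_supp M_piv]; split=> //.
  move=> i j; apply: contraR => out; rewrite mxE big1 // => k _.
  have [lt_ki | le_ik] := ltnP k i; first by rewrite Utrig ?mul0r.
  have [-> | /M_supp /andP[lt_kr le_ckj]] := eqVneq (M k j) 0.
    by rewrite mulr0.
  case/negP: out; rewrite (leq_ltn_trans le_ik lt_kr).
  exact: leq_trans (increasing_pivots_leq piv le_ik lt_kr) le_ckj.
move=> i j lt_ir ci; rewrite mxE (bigD1 i) //= big1 ?addr0.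
  by rewrite mulf_neq0 // M_piv.
move=> k neq_ki; have [lt_ki | le_ik] := ltnP k i.
  by rewrite Utrig ?mul0r.
have [-> | /M_supp /andP[lt_kr le_ckj]] := eqVneq (M k j) 0.
  by rewrite mulr0.
have lt_ik : (i < k)%N by rewrite ltn_neqAle eq_sym neq_ki.
by case: piv => _ _ /(_ _ _ lt_ik lt_kr); rewrite ci ltnNge le_ckj.
Qed.

Definition pivot_mx (F : fieldType) (m n r : nat) (c : nat -> nat) :
    'M[F]_(m, n) :=
  \matrix_(i, j) ((i < r)%N && (c i == j))%:R.

(** The first [r] rows are distinct unit vectors, so their matrix has its transpose as right
    inverse; the other factor [pid_mx r] has rank [r]. *)
Lemma rank_pivot_mx (F : fieldType) (m n r : nat) (c : nat -> nat) :
  increasing_pivots m n r c -> \rank (pivot_mx F m n r c) = r.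
Proof.
move=> piv; have [le_rm c_lt _] := piv.
have -> : pivot_mx F m n r c = (pid_mx r : 'M_(m, r)) *m pivot_mx F r n r c.
  apply/matrixP=> i j; rewrite !mxE.
  have [lt_ir | le_ri] := ltnP i r; last first.
    rewrite big1 // => k _; rewrite mxE [(i < r)%N]ltnNge le_ri andbF mul0r //.
  rewrite (bigD1 (Ordinal lt_ir)) //= big1 ?addr0 => [|k neq_k].
    by rewrite !mxE /= eqxx lt_ir mul1r.
  rewrite mxE; case: eqP => [eq_ik | _]; last by rewrite mul0r.
  by case/eqP: neq_k; apply: val_inj.
have free : row_free (pivot_mx F r n r c).
  apply/row_freeP; exists (pivot_mx F r n r c)^T.
  apply/matrixP=> i j; rewrite !mxE.
  rewrite (bigD1 (Ordinal (c_lt i (ltn_ord i)))) //= big1 ?addr0.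
    rewrite !mxE /= !ltn_ord eqxx mul1r; congr (_%:R); apply: congr1.
    apply/eqP/eqP => [/esym eq_c | -> //]; apply: val_inj.
    exact: increasing_pivots_inj piv _ _ eq_c.
  move=> k neq_k; rewrite !mxE ltn_ord /=.
  by case: eqP => [eq_ck | _]; rewrite ?mul0r //; case/eqP: neq_k; apply: val_inj.
by rewrite mxrankMfree // rank_pid_mx.
Qed.

Lemma pivot_mx_barcode (F : fieldType) (m n r : nat) (c : nat -> nat) :
  increasing_pivots m n r c -> barcode_form (pivot_mx F m n r c).
Proof.
move=> piv; have [_ c_lt c_incr] := piv.
(* The rank occurs in the type of the function to be supplied, so it must become [r] first. *)
rewrite /barcode_form (rank_pivot_mx F piv).
exists (fun k : 'I_r => Ordinal (c_lt k (ltn_ord k))); split.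
  by move=> k k' /= lt_kk'; apply: c_incr.
move=> i j; rewrite mxE; case: existsP => [[k /andP[/eqP <- /eqP ->]] | out].
  by rewrite ltn_ord eqxx.
case: andP => // -[lt_ir /eqP ci]; case: out; exists (Ordinal lt_ir).
by rewrite eqxx; apply/eqP/val_inj.
Qed.

(** Row [k] of [M] starts at column [c k] with a nonzero entry. Used as row [c k] of [W], it starts
    on the diagonal, so [W] is triangular and invertible; [pivot_mx] then selects these rows. *)
Lemma echelon_factor (F : fieldType) (m n : nat) (M : 'M[F]_(m, n)) r c :
  echelon M r c ->
  exists W : 'M[F]_n,
    [/\ is_utrig_mx W, W \in unitmx & M = pivot_mx F m n r c *m W].
Proof.
case=> piv M_supp M_piv; have [le_rm c_lt c_incr] := piv.
(* The row with its pivot in column [i], if any; injectivity of the pivots makes it unique. *)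
pose row_at (i : 'I_n) := [pick k : 'I_m | (k < r)%N && (c k == i)].
pose W := \matrix_(i < n, j < n)
  if row_at i is Some k then M k j else (i == j)%:R.
have Wtrig : is_utrig_mx W.
  apply/is_utrig_mxP => i j lt_ji; rewrite mxE /row_at.
  case: pickP => [k /andP[_ /eqP ck] | _].
    by apply/eqP; apply: contraLR lt_ji => /M_supp; rewrite ck -leqNgt => /andP[].
  by rewrite -val_eqE gtn_eqF.
exists W; split=> //.
  rewrite utrig_unitmx //; apply/forallP => i; rewrite mxE /row_at.
  case: pickP => [k /andP[lt_kr /eqP ck] | _]; first exact: M_piv.
  by rewrite eqxx oner_neq0.
apply/matrixP => i j; rewrite mxE.
have [lt_ir | le_ri] := ltnP i r; last first.
  rewrite big1 => [|k _]; last by rewrite mxE ltnNge le_ri mul0r.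
  by apply/eqP; apply: contraLR le_ri => /M_supp; rewrite -ltnNge => /andP[].
rewrite (bigD1 (Ordinal (c_lt i lt_ir))) //= big1 ?addr0 => [|k neq_k].
  rewrite !mxE /= lt_ir eqxx mul1r /row_at.
  case: pickP => [k /andP[lt_kr /eqP ck] | /(_ i)]; last by rewrite lt_ir eqxx.
  by congr (M _ j); apply: val_inj; apply: increasing_pivots_inj piv _ _ (esym ck).
rewrite mxE; case: andP => [[_ /eqP ck] | _]; last by rewrite mul0r.
by case/eqP: neq_k; apply: val_inj.
Qed.

(** The order of quantifiers matters: [h] depends on [A] alone, while the [U] supplied later may
    depend on [h]. *)
Lemma barcode_reduction (F : fieldType) (m n : nat) (A : 'M[F]_(m, n)) :
  exists h : 'M[F]_m, h \in unitmx /\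
    forall U : 'M[F]_m, is_utrig_mx U -> U \in unitmx ->
    exists W : 'M[F]_n,
      [/\ is_utrig_mx W, W \in unitmx & barcode_form (U *m h *m A *m invmx W)].
Proof.
have [h [h_unit [r [c hA]]]] := echelon_exists A.
exists h; split=> // U Utrig U_unit.
have UhA := echelon_mul_utrig Utrig U_unit hA; have [piv _ _] := UhA.
have [W [Wtrig W_unit eqW]] := echelon_factor UhA.
exists W; split=> //; rewrite -(mulmxA U) eqW mulmxK //.
exact: pivot_mx_barcode.
Qed.

Lemma invmx_mul (F : fieldType) (n : nat) (g h : 'M[F]_n) :
  g \in unitmx -> h \in unitmx -> invmx (g *m h) = invmx h *m invmx g.
Proof.
move=> g_unit h_unit; have gh_unit : g *m h \in unitmx by rewrite unitmx_mul g_unit.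
by rewrite -[RHS](mulmxK gh_unit) mulmxA mulmxKV // mulVmx // mul1mx.
Qed.

Lemma gl_act_mul (F : fieldType) (l : nat) (n : 'I_l.+1 -> nat)
    (g h : forall i : 'I_l.+1, 'M[F]_(n i)) (A : persistence_module F n)
    (i : 'I_l) :
  in_GLprod g -> in_GLprod h ->
  gl_act g (gl_act h A) i = gl_act (fun j => g j *m h j) A i.
Proof. by move=> gG hG; rewrite /gl_act invmx_mul // !mulmxA. Qed.

(** Induction on the number [d] of maps from index [k] on. Triangularity at space [k] is what allows
    the map into that space to be treated next. *)
Lemma barcode_from (F : fieldType) (l : nat) (n : 'I_l.+1 -> nat) (k d : nat)
    (A : persistence_module F n) :
  (k + d)%N = l ->
  exists g : forall i : 'I_l.+1, 'M[F]_(n i),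
    [/\ in_GLprod g, forall i : 'I_l.+1, i = k :> nat -> is_utrig_mx (g i)
      & forall i : 'I_l, (k <= i)%N -> barcode_form (gl_act g A i)].
Proof.
elim: d k A => [|d IHd] k A eq_l.
  exists (fun i => 1%:M); split=> [i | i _ | i].
  - exact: unitmx1.
  - by rewrite /is_utrig_mx tr_scalar_mx scalar_mx_is_trig.
  - by rewrite -[k]addn0 eq_l leqNgt ltn_ord.
have lt_kl : (k < l)%N by rewrite -eq_l addnS ltnS leq_addr.
pose k0 := Ordinal lt_kl.
have [h0 [h0_unit h0P]] := barcode_reduction (A k0).
(* This base change at the target of map [k] also alters the following map, so the induction
   hypothesis is applied to [gl_act h A]. *)
pose h := dfwith (fun i : 'I_l.+1 => 1%:M : 'M[F]_(n i)) h0.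
have hG : in_GLprod h.
  by move=> i; rewrite /h; case: dfwithP => // j _; apply: unitmx1.
have [|g [gG g_trig gP]] := IHd k.+1 (gl_act h A); first by rewrite addSnnS.
have [W [Wtrig W_unit WP]] := h0P _ (g_trig (vtgt k0) erefl) (gG _).
(* Only the component at space [k] is overwritten by [W]; the maps of index above [k] do not involve
   that space and keep their barcode form. *)
pose f := dfwith (fun i => g i *m h i) W.
have fG : in_GLprod f.
  by move=> i; rewrite /f; case: dfwithP => // j _; rewrite unitmx_mul gG hG.
exists f; split=> //.
  move=> i eq_ik; have -> : i = vsrc k0 by apply: val_inj.
  by rewrite /f dfwith_in.
move=> i; rewrite leq_eqVlt => /predU1P[eq_ki | lt_ki].
  have -> : i = k0 by apply: val_inj.
  rewrite /gl_act /f dfwith_in dfwith_out; first by rewrite /h dfwith_in.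
  by rewrite -val_eqE /= neq_ltn ltnS leqnn.
have := gP i lt_ki; rewrite gl_act_mul // /gl_act /f !dfwith_out //.
  by rewrite -val_eqE /= neq_ltn lt_ki.
by rewrite -val_eqE /= neq_ltn ltnS ltnW.
Qed.

Theorem proposition2p4 (F : fieldType) (l : nat) (n : 'I_l.+1 -> nat)
    (A : persistence_module F n) :
  exists g : forall i : 'I_l.+1, 'M[F]_(n i),
    in_GLprod g /\ forall i : 'I_l, barcode_form (gl_act g A i).
Proof.
have [g [gG _ gP]] := barcode_from A (add0n l).
by exists g; split=> // i; apply: gP.
Qed.
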